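(* Let $n$ be a positive integer and $N=2^n$. Let $\delta,\alpha\in(0,1]$ be real numbers with $\alpha\le\delta/2$, $\delta\le2^{-5}$, and $$\frac{2\delta}{\alpha}\log\frac{1}{2\alpha}\le\log N.$$ Then there exists a set $A\subseteq\mathbb{Z}_2^n$ such that $\delta N\le|A|\le8\delta N$, $|\mathcal{R}_\alpha(A)|\ge\frac{\delta}{8\alpha^2}$, and for every integer $k$ with $2\le k\le\frac12\log(1/(8\delta))$ we have $T_k(\mathcal{R}_\alpha(A))\le\frac{8\delta}{\alpha^{2k}}$.
   Context: $\mathbb{Z}_2^n=(\mathbb{Z}/2\mathbb{Z})^n$ with inner product $\langle\vec x,\vec y\rangle=x_1y_1+\dots+x_ny_n\pmod 2$; $\log$ is the logarithm to base $2$. For $f:\mathbb{Z}_2^n\to\mathbb{C}$, $\widehat f(\vec r)=\sum_{\vec x\in\mathbb{Z}_2^n}(-1)^{\langle\vec r,\vec x\rangle}f(\vec x)$; $A(\vec x)$ is the indicator of $A$, and $\mathcal{R}_\alpha(A)=\{\vec r\in\mathbb{Z}_2^n:|\widehat A(\vec r)|\ge\alpha N\}$. For $B\subseteq\mathbb{Z}_2^n$, $T_k(B)=|\{(r_1,\dots,r_k,r_1',\dots,r_k')\in B^{2k}: r_1+\dots+r_k=r_1'+\dots+r_k'\}|$. *)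

(* Defs.v *)
From HB Require Import structures.
From mathcomp Require Import all_boot all_order all_algebra.
From mathcomp Require Import all_classical all_reals all_analysis.
Set Implicit Arguments. Unset Strict Implicit. Unset Printing Implicit Defensive.
Import Order.TTheory GRing.Theory Num.Theory.
Local Open Scope ring_scope.

Notation vec n := 'rV['Z_2]_n.

Definition ip (n : nat) (x y : vec n) : 'Z_2 := \sum_(i < n) x ord0 i * y ord0 i.

Definition log2 (R : realType) (x : R) : R := ln x / ln 2.

Definition fourierA (R : realType) (n : nat) (A : {set vec n}) (r : vec n) : R :=
  \sum_(x in A) (-1) ^+ (nat_of_ord (ip r x)).

Definition specA (R : realType) (n : nat) (alpha : R) (A : {set vec n}) : {set vec n} :=
  [set r | alpha * (2 ^+ n)%:R <= `|fourierA R A r| ].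

Definition Tk (n k : nat) (B : {set vec n}) : nat :=
  #|[set p : (k.-tuple (vec n)) * (k.-tuple (vec n)) |
      all (fun r => r \in B) p.1 && all (fun r => r \in B) p.2 &&
      (\sum_(r <- p.1) r == \sum_(r <- p.2) r)]|.

(* Main.v *)
(* Let p = 2^-d be the power of 1/2 in [2 alpha, 4 alpha) and m = floor (2 delta / alpha).
   The hypothesis on log N leaves room for m disjoint blocks B_i of d coordinates.
   Take for A the union of the subspaces of vectors vanishing on B_i.  These are
   independent events of probability p, so the Fourier transform of A factors over
   the blocks: it has size at least 2 alpha N (1 - m p) at the nonzero vectors supported
   in a single block, and at most p^2 N < alpha N at all other nonzero vectors.  Hence the
   spectrum is the union of the m subspaces V_i of vectors supported in B_i.
   Its energy T_k is at most the mean of (2^d X)^(2k), where X x is the number of blocks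
   on which x vanishes; X is binomial of small mean m p <= 8 delta, and
   4^k X^(2k) <= 4^(k X) - [X = 0] bounds the mean through generating functions. *)
Require Import Defs.
From HB Require Import structures.
From mathcomp Require Import all_boot all_order all_algebra.
From mathcomp Require Import all_classical all_reals all_analysis.
From mathcomp Require Import ring lra.
Import Order.TTheory GRing.Theory Num.Theory.
Local Open Scope ring_scope.

(** * Characters and subspaces of vectors vanishing on given coordinates *)

Definition zeros {n : nat} (J : {set 'I_n}) : {set vec n} :=
  [set x : vec n | [forall c in J, x ord0 c == 0]].

Lemma zerosP {n : nat} (J : {set 'I_n}) (x : vec n) :
  reflect (forall c, c \in J -> x ord0 c = 0) (x \in zeros J).
Proof.
rewrite inE; apply: (iffP forall_inP) => H c /H => [/eqP // | ->]; exact: eqxx.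
Qed.

Definition chi (R : realType) {n : nat} (r x : vec n) : R :=
  (-1) ^+ (nat_of_ord (ip r x)).

Lemma signZ2D (R : realType) (a b : 'Z_2) :
  (-1) ^+ nat_of_ord (a + b) = (-1) ^+ nat_of_ord a * (-1) ^+ nat_of_ord b :> R.
Proof. by rewrite -exprD /= -[RHS]signr_odd -[LHS]signr_odd modn2 oddb. Qed.

Lemma chi_prod (R : realType) (n : nat) (r x : vec n) :
  chi R r x = \prod_(c < n) (-1) ^+ nat_of_ord (r ord0 c * x ord0 c).
Proof.
rewrite /chi /ip.
apply: (big_morph (fun a : 'Z_2 => (-1) ^+ nat_of_ord a : R)) => // a b.
exact: signZ2D.
Qed.

Lemma chiDl (R : realType) (n : nat) (r s x : vec n) :
  chi R (r + s) x = chi R r x * chi R s x.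
Proof.
rewrite /chi -signZ2D; congr (_ ^+ nat_of_ord _).
by rewrite /ip -big_split; apply: eq_bigr => c _ /=; rewrite mxE mulrDl.
Qed.

Lemma chi0l (R : realType) (n : nat) (x : vec n) : chi R 0 x = 1.
Proof. by rewrite /chi /ip big1 // => c _; rewrite mxE mul0r. Qed.

Lemma chiC (R : realType) (n : nat) (r x : vec n) : chi R r x = chi R x r.
Proof.
by rewrite /chi /ip; congr (_ ^+ nat_of_ord _); apply: eq_bigr => c _; rewrite mulrC.
Qed.

Lemma sum_signZ2 (R : realType) (a : 'Z_2) :
  \sum_(y : 'Z_2) (-1) ^+ nat_of_ord (a * y) = 2 * (a == 0)%:R :> R.
Proof.
have [->|->] : a = 0 \/ a = 1.
- by case: a => [[|[|//]] i]; [left | right]; apply/val_inj.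
- by under eq_bigr do rewrite mul0r; rewrite big_const_ord eqxx /=; lra.
- by under eq_bigr do rewrite mul1r; rewrite !big_ord_recl big_ord0 /= mulr0; lra.
Qed.

(** The sum factors over coordinates: one in [J] allows only the value 0 and contributes 1, a free
    one contributes 2 or 0 by [sum_signZ2]. In particular [zeros (~: J)] is the annihilator of
    [zeros J]. *)
Lemma sum_chi_zeros (R : realType) (n : nat) (J : {set 'I_n}) (r : vec n) :
  \sum_(x in zeros J) chi R r x = 2 ^+ #|~: J| * (r \in zeros (~: J))%:R.
Proof.
(* Nonzero values are killed on [J], so the distributed product can range over all vectors. *)
transitivity (\prod_(c < n) \sum_(y : 'Z_2)
   (if (c \in J) && (y != 0) then 0 else (-1) ^+ nat_of_ord (r ord0 c * y)) : R).
  rewrite bigA_distr_bigA /=.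
  rewrite (reindex (fun x : vec n => [ffun c => x ord0 c])) /=; last first.
    exists (fun f => \row_c f c) => x _; first by apply/rowP => c; rewrite mxE ffunE.
    by apply/ffunP => c; rewrite ffunE mxE.
  rewrite big_mkcond; apply: eq_bigr => x _.
  case: zerosP => [H|H].
    rewrite chi_prod; apply: eq_bigr => c _; rewrite ffunE.
    by case: (boolP (c \in J)) => //= /H ->; rewrite eqxx.
  have [c cJ xc] : exists2 c, c \in J & x ord0 c != 0.
    apply/exists_inP; apply: contra_notT H => /exists_inPn H c /H.
    by rewrite negbK => /eqP.
  by rewrite (bigD1 c) //= ffunE cJ xc mul0r.
transitivity (\prod_(c in ~: J) (2 * (r ord0 c == 0)%:R) : R).
  rewrite [RHS]big_mkcond; apply: eq_bigr => c _; rewrite inE.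
  case: (boolP (c \in J)) => [cJ|cJ] /=; last by rewrite -sum_signZ2.
  by rewrite (bigD1 (0 : 'Z_2)) //= muln0 mod0n expr0 big1 ?addr0 // => y ->.
rewrite big_split prodr_const; congr (_ * _).
case: zerosP => [H|H]; first by rewrite big1 // => c /H ->; rewrite eqxx.
have [c cJ xc] : exists2 c, c \in ~: J & r ord0 c != 0.
  apply/exists_inP; apply: contra_notT H => /exists_inPn H c /H.
  by rewrite negbK => /eqP.
by rewrite (bigD1 c) //= (negbTE xc) mul0r.
Qed.

(** * Products of indicators and disjoint blocks of coordinates *)

Lemma prodr_forall (R : realType) (I : finType) (P Q : pred I) :
  \prod_(i | P i) (Q i)%:R = ([forall (i | P i), Q i])%:R :> R.
Proof.
case: forall_inP => [H|H]; first by rewrite big1 // => i /H ->.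
have [i Pi Qi] : exists2 i, P i & ~~ Q i.
  by apply/exists_inP; apply: contra_notT H => /exists_inPn H i /H /negPn.
by rewrite (bigD1 i) //= (negbTE Qi) mul0r.
Qed.

Lemma zerosU {n : nat} (J K : {set 'I_n}) (x : vec n) :
  (x \in zeros (J :|: K)) = (x \in zeros J) && (x \in zeros K).
Proof.
apply/zerosP/andP => [H|[/zerosP HJ /zerosP HK] c].
  by split; apply/zerosP => c Hc; apply: H; rewrite inE Hc ?orbT.
by rewrite inE => /orP[/HJ|/HK].
Qed.

Lemma zeros_bigcup {n m : nat} (B : 'I_m -> {set 'I_n}) (S : {set 'I_m}) (x : vec n) :
  (x \in zeros (\bigcup_(i in S) B i)) = [forall i in S, x \in zeros (B i)].
Proof.
apply/zerosP/forall_inP => [H i iS|H c /bigcupP[i iS cB]].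
  by apply/zerosP => c cB; apply: H; apply/bigcupP; exists i.
by move: (H i iS) => /zerosP; apply.
Qed.

Lemma card_disjoint_bigcup (T I : finType) (F : I -> {set T}) (S : {set I}) (d : nat) :
  (forall i j, i != j -> [disjoint F i & F j]) -> (forall i, #|F i| = d) ->
  #|\bigcup_(i in S) F i| = (#|S| * d)%N.
Proof.
move=> disjF cardF; rewrite big_mkcond -sum1_card partition_disjoint_bigcup; last first.
  move=> i j /disjF /disjoint_setI0 Fij; rewrite -setI_eq0; apply/eqP.
  by rewrite /=; case: ifP => _; case: ifP => _; rewrite ?finset.setI0 ?finset.set0I.
rewrite -sum_nat_const [RHS]big_mkcond; apply: eq_bigr => i _.
by case: ifP => _; rewrite sum1_card ?cards0.
Qed.

(** Serves to split the frequency condition of [sum_chi_zeros], for the union of the blocks in [S],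
    into one condition per block outside [S]. *)
Lemma setC_bigcup_blocks {n m : nat} (B : 'I_m -> {set 'I_n}) (S : {set 'I_m}) :
  (forall i j, i != j -> [disjoint B i & B j]) ->
  ~: (\bigcup_(i in S) B i) =
  ~: (\bigcup_i B i) :|: \bigcup_(i in ~: S) B i.
Proof.
move=> disjB; apply/setP => c; rewrite !inE.
apply/idP/orP => [H|[H|/bigcupP[i]]].
- case: (boolP (c \in \bigcup_i B i)) => [/bigcupP[i _ cB]|]; last by left.
  right; apply/bigcupP; exists i => //; rewrite inE; apply: contra H => iS.
  by apply/bigcupP; exists i.
- by apply: contra H => /bigcupP[i _ cB]; apply/bigcupP; exists i.
- rewrite inE => iS cB; apply/negP => /bigcupP[j jS cBj].
  have /disjB : i != j by apply: contra iS => /eqP ->.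
  by move/disjoint_setI0/setP/(_ c); rewrite !inE cB cBj.
Qed.

(** Expanding over sets [S] of blocks leaves character sums over subspaces, which recombine into a
    product. At [w = -1] the averaged product is the indicator of the complement of [A]; at
    [w = a - 1] it is [a] to the number of blocks on which [x] vanishes. *)
Lemma sum_chi_prod (R : realType) (n m d : nat) (B : 'I_m -> {set 'I_n}) (w : R)
    (r : vec n) :
  (forall i j, i != j -> [disjoint B i & B j]) -> (forall i, #|B i| = d) ->
  \sum_x chi R r x * \prod_i (1 + w * (x \in zeros (B i))%:R) =
  2 ^+ n * (r \in zeros (~: \bigcup_i B i))%:R *
    \prod_i ((r \in zeros (B i))%:R + w * 2 ^- d).
Proof.
move=> disjB cardB.
have E x : \prod_i (1 + w * (x \in zeros (B i))%:R) =
    \sum_(S : {set 'I_m}) w ^+ #|S| * (x \in zeros (\bigcup_(i in S) B i))%:R :> R.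
  under eq_bigr do rewrite addrC.
  rewrite bigA_distr; apply: eq_bigr => S _.
  by rewrite -big_mkcond big_split prodr_const prodr_forall zeros_bigcup.
rewrite (eq_bigr (fun x => \sum_(S : {set 'I_m})
    chi R r x * (w ^+ #|S| * (x \in zeros (\bigcup_(i in S) B i))%:R))); last first.
  by move=> x _; rewrite -mulr_sumr -E.
rewrite exchange_big.
rewrite [in RHS](eq_bigr (fun i => w * 2 ^- d + (r \in zeros (B i))%:R)); last first.
  by move=> i _; rewrite addrC.
rewrite bigA_distr mulr_sumr; apply: eq_bigr => S _.
transitivity (w ^+ #|S| * \sum_(x in zeros (\bigcup_(i in S) B i)) chi R r x).
  rewrite [in RHS]big_mkcond mulr_sumr; apply: eq_bigr => x _.
  by case: ifP => _; rewrite ?mulr1 ?mulr0 // mulrC.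
rewrite sum_chi_zeros setC_bigcup_blocks // zerosU zeros_bigcup.
have -> : \prod_i (if i \in S then w * 2 ^- d else (r \in zeros (B i))%:R) =
    (w * 2 ^- d) ^+ #|S| * ([forall i in ~: S, r \in zeros (B i)])%:R :> R.
  rewrite -prodr_forall -prodr_const [in RHS]big_mkcond.
  rewrite [X in _ = _ * X]big_mkcond -big_split; apply: eq_bigr => i _ /=.
  by rewrite finset.in_setC; case: ifP => _; rewrite /= ?mulr1 ?mul1r.
(* The blocks of [S] take up [#|S| * d] coordinates, which the factors [2 ^- d] compensate. *)
have -> : 2 ^+ n = 2 ^+ #|~: (\bigcup_(i in S) B i)| * 2 ^+ (#|S| * d) :> R.
  by rewrite -exprD -(card_disjoint_bigcup _ _ B S d disjB cardB) addnC cardsC card_ord.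
rewrite setC_bigcup_blocks // exprMn -exprVn -exprM (mulnC d) exprVn -mulnb natrM.
have /mulfV aV : (2 : R) ^+ (#|S| * d) != 0 by rewrite expf_neq0.
set a := 2 ^+ (#|S| * d) in aV *.
(* With [a / a] inserted, both sides agree as polynomials in [a] and its inverse, as [ring]
   requires. *)
transitivity (w ^+ #|S| * (2 ^+ #|~: (\bigcup_i B i) :|: \bigcup_(i in ~: S) B i| *
 ((r \in zeros (~: \bigcup_i B i))%:R * [forall i in ~: S, r \in zeros (B i)]%:R)) * (a / a)); first by rewrite aV mulr1.
ring.
Qed.

(** * The union of subspaces and its Fourier transform *)

Lemma zeros0 {n : nat} (J : {set 'I_n}) : 0 \in zeros J.
Proof. by apply/zerosP => c _; rewrite mxE. Qed.

Lemma zerosT {n : nat} (x : vec n) : (x \in zeros [set: 'I_n]) = (x == 0).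
Proof.
apply/zerosP/eqP => [H|-> c _]; last by rewrite mxE.
by apply/rowP => c; rewrite H ?mxE ?finset.in_setT.
Qed.

Lemma sum_chi (R : realType) (n : nat) (r : vec n) :
  \sum_x chi R r x = 2 ^+ n * (r == 0)%:R.
Proof.
have := sum_chi_zeros R n finset.set0 r.
rewrite finset.setC0 zerosT cardsT card_ord => <-; apply: eq_bigl => x.
by symmetry; apply/zerosP => c; rewrite finset.in_set0.
Qed.

Definition cylinder_union {n m : nat} (B : 'I_m -> {set 'I_n}) : {set vec n} :=
  \bigcup_i zeros (B i).

(** The complement of the union is handled by [sum_chi_prod] at [w = -1] and subtracted from the
    character sum over the whole group. *)
Lemma fourier_cylinder_union (R : realType) (n m d : nat) (B : 'I_m -> {set 'I_n})
    (r : vec n) :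
  (forall i j, i != j -> [disjoint B i & B j]) -> (forall i, #|B i| = d) ->
  fourierA R (cylinder_union B) r =
  2 ^+ n * ((r == 0)%:R - (r \in zeros (~: \bigcup_i B i))%:R *
    \prod_i ((r \in zeros (B i))%:R - 2 ^- d)).
Proof.
move=> disjB cardB.
have := sum_chi_prod R n m d B (-1) r disjB cardB.
rewrite [in RHS](eq_bigr (fun i => (r \in zeros (B i))%:R - 2 ^- d)); last first.
  by move=> i _; rewrite mulN1r.
rewrite mulrBr -sum_chi -mulrA => <-; rewrite -sumrB /fourierA big_mkcond.
apply: eq_bigr => x _; rewrite -/(chi R r x).
rewrite (eq_bigr (fun i => (x \notin zeros (B i))%:R)); last first.
  by move=> i _; case: (_ \in _); rewrite /= ?mulr0 ?mulr1 ?addr0 ?subrr.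
rewrite prodr_forall; case: (boolP (x \in cylinder_union B)) => [/bigcupP[i _ xB]|xB].
  case: forall_inP => [/(_ i isT)|_]; first by rewrite xB.
  by rewrite mulr0 subr0.
case: forall_inP => [_|[]]; first by rewrite mulr1 subrr.
by move=> i _; apply: contra xB => xB; apply/bigcupP; exists i.
Qed.

(** The cardinality is the Fourier transform at [0]. *)
Lemma card_cylinder_union (R : realType) (n m d : nat) (B : 'I_m -> {set 'I_n}) :
  (forall i j, i != j -> [disjoint B i & B j]) -> (forall i, #|B i| = d) ->
  #|cylinder_union B|%:R = 2 ^+ n * (1 - (1 - 2 ^- d) ^+ m) :> R.
Proof.
move=> disjB cardB; have := fourier_cylinder_union R n m d B 0 disjB cardB.
rewrite eqxx zeros0 mul1r (eq_bigr (fun=> 1 - 2 ^- d)); last first.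
  by move=> i _; rewrite zeros0.
rewrite prodr_const card_ord => <-; rewrite -sum1_card natr_sum.
by apply: eq_bigr => x _; rewrite -/(chi R 0 x) chi0l.
Qed.

Lemma zeros_setC_sub {n m : nat} (B : 'I_m -> {set 'I_n}) (i j : 'I_m) (r : vec n) :
  [disjoint B i & B j] -> r \in zeros (~: B i) -> r \in zeros (B j).
Proof.
move=> /disjoint_setI0/setP Bij /zerosP ri; apply/zerosP => c cj; apply: ri.
by have := Bij c; rewrite !inE cj andbT => ->.
Qed.

(** A nonzero vector supported in [B i] vanishes on every other block, so exactly one factor is
    [- 2 ^- d], and its sign cancels the one in front of the product. *)
Lemma fourier_dual_block (R : realType) (n m d : nat) (B : 'I_m -> {set 'I_n})
    (i : 'I_m) (r : vec n) :
  (forall i j, i != j -> [disjoint B i & B j]) -> (forall i, #|B i| = d) ->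
  r \in zeros (~: B i) -> r != 0 ->
  fourierA R (cylinder_union B) r = 2 ^+ n * (2 ^- d * (1 - 2 ^- d) ^+ m.-1).
Proof.
move=> disjB cardB ri r0; rewrite (fourier_cylinder_union _ _ _ _ _ _ disjB cardB).
congr (_ * _); rewrite (negbTE r0) sub0r.
have -> : r \in zeros (~: \bigcup_i B i).
  apply/zerosP => c; rewrite finset.in_setC => cB; move/zerosP: ri; apply.
  by rewrite finset.in_setC; apply: contra cB => cB; apply/bigcupP; exists i.
have /negbTE rBi : r \notin zeros (B i).
  apply: contra r0 => rBi.
  by rewrite -zerosT -(finset.setUCr (B i)) zerosU rBi ri.
rewrite (bigD1 i) //= rBi (eq_bigr (fun=> 1 - 2 ^- d)); last first.
  move=> j ji; rewrite (zeros_setC_sub B i j) //.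
  by apply: disjB; rewrite eq_sym.
rewrite prodr_const (@eq_card _ _ (predC1 i)) // cardC1 card_ord.
by rewrite mul1r sub0r mulNr opprK.
Qed.

(** Either [r] is nonzero outside all blocks and the transform is 0, or it is nonzero on two blocks,
    each giving a factor of modulus [2 ^- d]; all other factors have modulus at most 1. *)
Lemma fourier_off_blocks (R : realType) (n m d : nat) (B : 'I_m -> {set 'I_n})
    (r : vec n) :
  (forall i j, i != j -> [disjoint B i & B j]) -> (forall i, #|B i| = d) ->
  (0 < m)%N -> (forall i, r \notin zeros (~: B i)) ->
  `|fourierA R (cylinder_union B) r| <= 2 ^+ n * (2 ^- d) ^+ 2.
Proof.
move=> disjB cardB m0 rB; rewrite (fourier_cylinder_union _ _ _ _ _ _ disjB cardB).
have p0 : 0 <= (2 : R) ^- d by rewrite invr_ge0 exprn_ge0.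
have p1 : (2 : R) ^- d <= 1 by rewrite invf_le1 ?exprn_gt0 // exprn_ege1 // ler1n.
rewrite normrM ger0_norm ?exprn_ge0 // ler_wpM2l ?exprn_ge0 //.
(* The zero vector is supported in every block, and [0 < m] provides one. *)
have -> : r == 0 = false.
  by apply/eqP => r0; have := rB (Ordinal m0); rewrite r0 zeros0.
rewrite sub0r normrN normrM.
case: (boolP (r \in zeros (~: \bigcup_i B i))) => [/zerosP rU|_]; last first.
  by rewrite normr0 mul0r exprn_ge0.
(* As [r] is not supported in [B i], it is nonzero on some other block; two uses yield two distinct
   blocks. *)
have out i : exists2 j, j != i & r \notin zeros (B j).
  have /zerosP := rB i; rewrite -existsNE => -[c].
  move/not_implyP => [ci rc].
  case: (boolP (c \in \bigcup_i B i)) => [/bigcupP[j _ cj]|cU]; last first.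
    by case: rc; apply: rU; rewrite finset.in_setC.
  exists j; first by apply: contraTneq ci => <-; rewrite finset.in_setC cj.
  by apply/zerosP => /(_ c cj).
have [i _ ri] := out (Ordinal m0).
have [j ji rj] := out i.
rewrite normr1 mul1r (bigD1 i) //= (bigD1 j) //= (negbTE ri) (negbTE rj) !sub0r.
rewrite !normrM !normrN !(ger0_norm p0) expr2 mulrA ler_piMr ?mulr_ge0 //.
rewrite normr_prod; apply: prodr_ile1 => k _; rewrite normr_ge0 /=.
case: (_ \in _); first by rewrite ger0_norm ?subr_ge0 // lerBlDr lerDl.
by rewrite sub0r normrN ger0_norm.
Qed.

(** * Additive energy as a moment *)

Lemma sum_chi_exp (R : realType) (n k : nat) (f : vec n -> R) (x : vec n) :
  (\sum_r f r * chi R r x) ^+ k =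
  \sum_(t : k.-tuple (vec n)) (\prod_(r <- t) f r) * chi R (\sum_(r <- t) r) x.
Proof.
rewrite -[k in LHS]card_ord -prodr_const bigA_distr_bigA /=.
rewrite (reindex (fun t : k.-tuple (vec n) => [ffun i => tnth t i])) /=; last first.
  exists (fun g => [tuple g i | i < k]) => t _.
    by apply: eq_from_tnth => i; rewrite tnth_mktuple ffunE.
  by apply/ffunP => i; rewrite ffunE tnth_mktuple.
apply: eq_bigr => t _; under eq_bigr do rewrite ffunE.
rewrite big_split /= !big_tuple; congr (_ * _).
symmetry; apply: (big_morph (fun r => chi R r x)) => [r s|]; [exact: chiDl|exact: chi0l].
Qed.

Lemma vecD_eq0 (n : nat) (a b : vec n) : (a + b == 0) = (a == b).
Proof.
rewrite addr_eq0; congr (_ == _); apply/rowP => c; rewrite mxE.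
by case: (b ord0 c) => [[|[|//]] i]; apply/val_inj.
Qed.

(** By orthogonality the moment is [2 ^+ n] times a weighted count of solutions of the energy
    equation; in characteristic 2 a zero total means equal half sums. Weights are at least 1 on
    tuples from [C] and nonnegative elsewhere. *)
Lemma Tk_le_moment (R : realType) (n k : nat) (C : {set vec n}) (f : vec n -> R) :
  (forall r, (r \in C)%:R <= f r) ->
  2 ^+ n * (Tk k C)%:R <= \sum_x (\sum_r f r * chi R r x) ^+ (2 * k).
Proof.
move=> fC; pose w (t : k.-tuple (vec n)) := \prod_(r <- t) f r.
have f0 r : 0 <= f r by apply: le_trans (fC r); rewrite ler0n.
have w0 t : 0 <= w t by apply: prodr_ge0.
have w1 t : all (fun r => r \in C) (val t) -> 1 <= w t.
  move=> /allP tC; rewrite /w big_seq; apply: (big_ind (fun y => 1 <= y)) => // [y z|r /tC rC].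
    exact: mulr_ege1.
  by have := fC r; rewrite rC.
have -> : \sum_x (\sum_r f r * chi R r x) ^+ (2 * k) =
    \sum_(p : k.-tuple (vec n) * k.-tuple (vec n))
      2 ^+ n * (w p.1 * w p.2 * (\sum_(r <- p.1) r == \sum_(r <- p.2) r)%:R).
  rewrite -(pair_bigA _ (fun t u =>
    2 ^+ n * (w t * w u * (\sum_(r <- t) r == \sum_(r <- u) r)%:R))) /=.
  transitivity (\sum_x \sum_(t : k.-tuple (vec n)) \sum_(u : k.-tuple (vec n))
      w t * w u * chi R (\sum_(r <- t) r + \sum_(r <- u) r) x).
    apply: eq_bigr => x _; rewrite mul2n -addnn exprD !sum_chi_exp mulr_suml.
    apply: eq_bigr => t _; rewrite mulr_sumr; apply: eq_bigr => u _.
    by rewrite chiDl mulrACA.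
  rewrite exchange_big; apply: eq_bigr => t _.
  rewrite exchange_big; apply: eq_bigr => u _ /=.
  by rewrite -mulr_sumr sum_chi vecD_eq0 mulrCA.
rewrite -mulr_sumr ler_wpM2l ?exprn_ge0 // /Tk -sum1_card natr_sum big_mkcond.
apply: ler_sum => p _; case: ifP; last by rewrite !mulr_ge0.
rewrite inE => /andP[/andP[/w1 w1p /w1 w2p] ->].
by rewrite mulr1 mulr_ege1.
Qed.

(** * Moment bounds through generating functions *)

Lemma prodr_1D_indicator (R : realType) (I : finType) (P : pred I) (a : R) :
  \prod_i (1 + (a - 1) * (P i)%:R) = a ^+ #|P|.
Proof.
rewrite -prodr_const [RHS]big_mkcond; apply: eq_bigr => i _.
by rewrite unfold_in; case: (P i); rewrite ?mulr1 ?mulr0 ?addr0 // addrC subrK.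
Qed.

Lemma double_le_exp2 (j : nat) : (0 < j)%N -> (2 * j <= 2 ^ j)%N.
Proof.
by case: j => // j _; rewrite expnS leq_mul2l /= ltn_expl.
Qed.

(* With X = \sum_i P i, the right-hand side is 4^(k X) - [X = 0]; it is kept as a
   difference of products because [sum_chi_prod] averages such products exactly. *)
Lemma count_moment_le (R : realType) (I : finType) (P : pred I) (k : nat) :
  (0 < k)%N ->
  4 ^+ k * (\sum_i (P i)%:R) ^+ (2 * k) <=
  \prod_i (1 + (4 ^+ k - 1) * (P i)%:R) - \prod_i (1 + (0 - 1) * (P i)%:R) :> R.
Proof.
move=> k0; rewrite !prodr_1D_indicator.
have -> : \sum_i (P i)%:R = #|P|%:R :> R.
  by rewrite -sum1_card natr_sum [RHS]big_mkcond; apply: eq_bigr => i _;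
     rewrite unfold_in; case: (P i).
(* At count 0 both sides vanish since [k > 0]; otherwise the claim is [2 * j.+1 <= 2 ^ j.+1] raised
   to the power [2 * k]. *)
case: #|P| => [|j]; first by rewrite !expr0 subrr expr0n muln_eq0 /= eqn0Ngt k0 mulr0.
rewrite [0 ^+ _]expr0n subr0.
have -> : 4 = 2 ^+ 2 :> R by rewrite -natrX.
rewrite -!exprM -exprMn (mulnC (2 * k)%N) (exprM 2 j.+1) -natrX -natrM.
by rewrite lerXn2r ?nnegrE ?ler0n // ler_nat double_le_exp2.
Qed.

(** Each of the [m] terms of the cofactor of [a - b] is at most [a ^+ m.-1]; [1 <= a] lets the
    exponent rise to [m], which removes the predecessor. *)
Lemma ler_subXX (R : realType) (a b : R) (m : nat) :
  0 <= b <= a -> 1 <= a -> a ^+ m - b ^+ m <= (a - b) * (m%:R * a ^+ m).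
Proof.
move=> /andP[b0 ba] a1; have a0 : 0 <= a by lra.
rewrite subrXX ler_wpM2l ?subr_ge0 //.
rewrite mulr_natl -[X in _ *+ X]card_ord -sumr_const.
apply: ler_sum => i _; apply: (@le_trans _ _ (a ^+ (m.-1 - i) * a ^+ i)).
  by rewrite ler_wpM2l ?exprn_ge0 // lerXn2r ?nnegrE.
rewrite -exprD ler_weXn2l // subnK ?leq_pred //.
by have := ltn_ord i; case: m i.
Qed.

Lemma card_zeros (R : realType) (n : nat) (J : {set 'I_n}) :
  #|zeros J|%:R = 2 ^+ #|~: J| :> R.
Proof.
have := sum_chi_zeros R n J 0; rewrite zeros0 mulr1 => <-.
by rewrite -sum1_card natr_sum; apply: eq_bigr => x _; rewrite chi0l.
Qed.

Lemma Tk_dual_blocks (R : realType) (n m d k : nat) (B : 'I_m -> {set 'I_n})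
    (C : {set vec n}) :
  (forall i j, i != j -> [disjoint B i & B j]) -> (forall i, #|B i| = d) ->
  (0 < k)%N -> C \subset \bigcup_i zeros (~: B i) ->
  (Tk k C)%:R <=
  (2 ^+ d) ^+ (2 * k) * (m%:R * 2 ^- d) * (1 + (4 ^+ k - 1) * 2 ^- d) ^+ m :> R.
Proof.
move=> disjB cardB k0 /fintype.subsetP CB.
have N0 : 0 < 2 ^+ n :> R by rewrite exprn_gt0.
have K0 : 0 < 4 ^+ k :> R by rewrite exprn_gt0.
have K1 : 1 <= 4 ^+ k :> R by rewrite exprn_ege1 // ler1n.
have p0 : 0 <= (2 : R) ^- d by rewrite invr_ge0 exprn_ge0.
have p1 : (2 : R) ^- d <= 1 by rewrite invf_le1 ?exprn_gt0 // exprn_ege1 // ler1n.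
(* This majorant of the indicator of [C] counts 0 once per block, but each dual block transforms
   into [2 ^+ d] times the indicator of [zeros (B i)]. *)
pose f r : R := \sum_i (r \in zeros (~: B i))%:R.
have fC r : (r \in C)%:R <= f r.
  case: (boolP (r \in C)) => [/CB/bigcupP[i _ ri]|_]; last exact: sumr_ge0.
  by rewrite /f (bigD1 i) //= ri lerDl sumr_ge0.
have fE x : \sum_r f r * chi R r x = 2 ^+ d * \sum_i (x \in zeros (B i))%:R.
  rewrite (eq_bigr (fun r => \sum_i (r \in zeros (~: B i))%:R * chi R r x)); last first.
    by move=> r _; rewrite mulr_suml.
  rewrite exchange_big mulr_sumr; apply: eq_bigr => i _ /=.
  have := sum_chi_zeros R n (~: B i) x; rewrite finset.setCK cardB => <-.
  rewrite [RHS]big_mkcond; apply: eq_bigr => r _; rewrite chiC.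
  by case: (_ \in _); rewrite ?mul1r ?mul0r.
(* [count_moment_le] leaves a difference of two [m]-th powers; [ler_subXX] extracts the gap
   [4 ^+ k * 2 ^- d] of their bases, hence the small factor [m * 2 ^- d]. *)
have moment : 4 ^+ k * \sum_x (\sum_i (x \in zeros (B i))%:R) ^+ (2 * k) <=
    2 ^+ n * ((4 ^+ k * 2 ^- d) * (m%:R * (1 + (4 ^+ k - 1) * 2 ^- d) ^+ m)) :> R.
  have prodE w : \sum_x \prod_i (1 + w * (x \in zeros (B i))%:R) =
      2 ^+ n * (1 + w * 2 ^- d) ^+ m :> R.
    have := sum_chi_prod R n m d B w 0 disjB cardB; rewrite zeros0 mulr1.
    rewrite [in RHS](eq_bigr (fun=> 1 + w * 2 ^- d)); last first.
      by move=> i _; rewrite zeros0.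
    rewrite prodr_const card_ord => <-.
    by apply: eq_bigr => x _; rewrite chi0l mul1r.
  rewrite mulr_sumr; apply: (@le_trans _ _ (\sum_x
      (\prod_i (1 + (4 ^+ k - 1) * (x \in zeros (B i))%:R) -
       \prod_i (1 + (0 - 1) * (x \in zeros (B i))%:R)))).
    apply: ler_sum => x _.
    exact: (count_moment_le R _ (fun i => x \in zeros (B i)) k k0).
  rewrite sumrB !prodE -mulrBr ler_wpM2l ?(ltW N0) //.
  have -> : 4 ^+ k * 2 ^- d = (1 + (4 ^+ k - 1) * 2 ^- d) - (1 + (0 - 1) * 2 ^- d) :> R.
    by ring.
  apply: ler_subXX; last by rewrite lerDl mulr_ge0 ?subr_ge0.
  apply/andP; split; first by lra.
  by rewrite lerD2l ler_wpM2r //; lra.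
have := Tk_le_moment R n k C f fC.
under eq_bigr do rewrite fE exprMn.
rewrite -mulr_sumr => T; rewrite -(ler_pM2l N0) -(ler_pM2l K0).
have Q0 : 0 <= ((2 : R) ^+ d) ^+ (2 * k) by rewrite !exprn_ge0.
move: (ler_wpM2l Q0 moment) (ler_wpM2l (ltW K0) T).
move: (_ ^- d) (_ ^+ (2 * k)) (\sum_x _) (_ ^+ m) => p Q S a.
nra.
Qed.

(** * Existence of blocks and elementary estimates *)

Lemma exists_blocks (n m d : nat) : (m * d <= n)%N ->
  exists B : 'I_m -> {set 'I_n},
    (forall i j, i != j -> [disjoint B i & B j]) /\ (forall i, #|B i| = d).
Proof.
move=> mdn.
have le_n : (#|{: 'I_m * 'I_d}| <= n)%N by rewrite card_prod !card_ord.
pose g u := widen_ord le_n (enum_rank u).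
have g_inj : injective g.
  by move=> u v /(congr1 val) /= uv; apply/enum_rank_inj/val_inj.
exists (fun i => [set g (i, j) | j : 'I_d]); split => [i j ij|i].
  rewrite -setI_eq0; apply/eqP/setP => c; rewrite !inE.
  apply/negP => /andP[/imsetP[a _ ->] /imsetP[b _ /g_inj [ij' _]]].
  by rewrite ij' eqxx in ij.
by rewrite card_imset ?card_ord // => a b /g_inj [].
Qed.

Lemma bernoulli_inequality (R : realType) (x : R) (m : nat) :
  -1 <= x -> 1 + m%:R * x <= (1 + x) ^+ m.
Proof.
move=> x1; elim: m => [|m IH]; first by rewrite mul0r addr0 expr0.
have x0 : 0 <= 1 + x by lra.
rewrite exprSr; apply: le_trans (ler_wpM2r x0 IH).
have : 0 <= m%:R * x ^+ 2 by rewrite mulr_ge0 ?sqr_ge0.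
rewrite -natr1 expr2; lra.
Qed.

(** The inequality [1 + x <= expR x] at [x = -1/2] is squared. *)
Lemma expR1_le4 (R : realType) : expR 1 <= 4 :> R.
Proof.
have H : 1 / 2 <= expR (- (1 / 2)) :> R.
  by have := expR_ge1Dx (- (1 / 2) : R); lra.
have E : expR (- (1 / 2)) * expR (- (1 / 2)) * expR 1 = 1 :> R.
  by rewrite -!expRD -[RHS]expR0; congr expR; lra.
have H2 : 1 / 4 <= expR (- (1 / 2)) * expR (- (1 / 2)) :> R by nra.
have := ler_wpM2r (expR_ge0 (1 : R)) H2; rewrite E; lra.
Qed.

Lemma exp2_le_log2 (R : realType) (y : R) (j : nat) :
  0 < y -> (2 ^+ j <= y) = (j%:R <= log2 y).
Proof.
move=> y0; have ln2 : 0 < ln 2 :> R by rewrite ln_gt0 // ltr1n.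
by rewrite /log2 ler_pdivlMr // mulr_natl -lnXn // ler_ln ?posrE ?exprn_gt0.
Qed.

(* The inner power is taken in the semiring [nat]. *)
Lemma natr_expr2 (R : realType) (n : nat) : (2 ^+ n)%R%:R = 2 ^+ n :> R.
Proof. by rewrite natrX. Qed.

(** * The large spectrum of the union *)

Lemma spec_sub_dual_blocks (R : realType) (n m d : nat) (B : 'I_m -> {set 'I_n})
    (alpha : R) :
  (forall i j, i != j -> [disjoint B i & B j]) -> (forall i, #|B i| = d) ->
  (0 < m)%N -> (2 ^- d) ^+ 2 < alpha ->
  specA alpha (cylinder_union B) \subset \bigcup_i zeros (~: B i).
Proof.
move=> disjB cardB m0 p2; apply/fintype.subsetP => r; rewrite inE natr_expr2 => spec.
apply/negP => /negP rB.
have off i : r \notin zeros (~: B i).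
  by apply: contra rB => ri; apply/bigcupP; exists i.
have := fourier_off_blocks R n m d B r disjB cardB m0 off.
rewrite leNgt => /negP[]; apply: lt_le_trans spec.
by rewrite mulrC ltr_pM2r ?exprn_gt0.
Qed.

(** The dual blocks meet only in 0, and by [fourier_dual_block] the hypothesis on [alpha] puts all
    their nonzero vectors in the spectrum. *)
Lemma card_spec_ge (R : realType) (n m d : nat) (B : 'I_m -> {set 'I_n}) (alpha : R) :
  (forall i j, i != j -> [disjoint B i & B j]) -> (forall i, #|B i| = d) ->
  alpha <= 2 ^- d * (1 - 2 ^- d) ^+ m.-1 ->
  m%:R * (2 ^+ d - 1) <= #|specA alpha (cylinder_union B)|%:R :> R.
Proof.
move=> disjB cardB ap.
pose V i := zeros (~: B i) :\ 0.
have cardV i : #|V i| = (2 ^ d).-1.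
  have := cardsD1 0 (zeros (~: B i)); rewrite zeros0 add1n => E.
  have : #|zeros (~: B i)| = (2 ^ d)%N.
    apply/eqP; rewrite -(eqr_nat R) natrX (card_zeros R).
    by rewrite finset.setCK cardB.
  by rewrite E => <-.
have disjV i j : i != j -> [disjoint V i & V j].
  move=> /disjB Bij; rewrite -setI_eq0; apply/eqP/setP => r.
  rewrite finset.in_setI !in_setD1 finset.in_set0; apply/negP.
  move=> /andP[/andP[r0 /(zeros_setC_sub B i j r Bij) rj] /andP[_ rj']].
  by rewrite -zerosT -(finset.setUCr (B j)) zerosU rj rj' in r0.
have := card_disjoint_bigcup _ _ V finset.setT _ disjV cardV.
rewrite cardsT card_ord => E.
have -> : 2 ^+ d - 1 = (2 ^ d).-1%:R :> R.
  by rewrite -subn1 natrB ?expn_gt0 // natrX.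
rewrite -natrM -E ler_nat subset_leq_card //; apply/fintype.subsetP => r.
move=> /bigcupP[i _]; rewrite in_setD1 => /andP[r0 ri].
rewrite inE natr_expr2 (fourier_dual_block R n m d B i r disjB cardB ri r0).
have N0 : 0 < 2 ^+ n :> R by rewrite exprn_gt0.
rewrite mulrC; apply: le_trans (ler_norm _).
by rewrite (ler_pM2l N0).
Qed.

(** * Choice of parameters and the four bounds *)

Theorem theorem26 (R : realType) (n : nat) (delta alpha : R) :
  (0 < n)%N ->
  0 < delta <= 1 -> 0 < alpha <= 1 ->
  alpha <= delta / 2 -> delta <= 2 ^- 5 ->
  (2 * delta / alpha) * log2 (1 / (2 * alpha)) <= log2 ((2 ^ n)%N%:R) ->
  exists A : {set vec n},
    [/\ delta * (2 ^ n)%N%:R <= #|A|%:R,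
        #|A|%:R <= 8 * delta * (2 ^ n)%N%:R,
        delta / (8 * alpha ^+ 2) <= #|specA alpha A|%:R &
        forall k : nat, (2 <= k)%N -> k%:R <= log2 (1 / (8 * delta)) / 2 ->
          (Tk k (specA alpha A))%:R <= 8 * delta / alpha ^+ (2 * k)].
Proof.
move=> n0 /andP[delta0 _] /andP[alpha0 _] alpha_delta delta_small.
have {}delta_small : 32 * delta <= 1.
  move: delta_small; rewrite -[_ ^- 5]mul1r ler_pdivlMr ?exprn_gt0 //.
  by rewrite -natrX mulrC.
have ln2 : 0 < ln 2 :> R by rewrite ln_gt0 // ltr1n.
have -> : log2 (2 ^ n)%N%:R = n%:R :> R.
  by rewrite /log2 natrX lnXn // -[ln 2 *+ n]mulr_natl mulfK // gt_eqF.
set L := log2 _ => Ln.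
have y0 : 0 < 1 / (2 * alpha) by rewrite divr_gt0 // mulr_gt0.
have L0 : 0 <= L.
  rewrite -[0]/(0%:R) -exp2_le_log2 // expr0 ler_pdivlMr ?mulr_gt0 //; lra.
(* Here [d], and below [m], round down the two factors of the hypothesis on [n], whence
   [m * d <= n]. *)
have /andP[dL Ld] := truncn_itv L0.
move: (Num.truncn L) dL Ld => d dL Ld.
have ratio0 : 0 <= 2 * delta / alpha by rewrite divr_ge0 ?mulr_ge0 ?ltW.
have /andP[mr rm] := truncn_itv ratio0.
move: (Num.truncn _) mr rm => m mr rm.
have mdn : (m * d <= n)%N.
  by rewrite -(ler_nat R) natrM; apply: le_trans Ln; rewrite ler_pM.
have [B [disjB cardB]] := exists_blocks n m d mdn.
move: dL; rewrite -exp2_le_log2 // ler_pdivlMr ?mulr_gt0 // => Qle.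
move: Ld; rewrite ltNge -exp2_le_log2 // -ltNge ltr_pdivrMr ?mulr_gt0 // exprS => Qgt.
move: mr rm; rewrite ler_pdivlMr // ltr_pdivrMr // -natr1 => mle mgt.
have Q0 : 0 < 2 ^+ d :> R by rewrite exprn_gt0.
have pQ : 2 ^- d * 2 ^+ d = 1 :> R by rewrite mulVf // gt_eqF.
have p0 : 0 < 2 ^- d :> R by rewrite invr_gt0.
have p_lo : 2 * alpha <= 2 ^- d.
  by have := ler_wpM2l (ltW p0) Qle; rewrite mulrA pQ mul1r mulr1.
have p_hi : 2 ^- d < 4 * alpha.
  have : 2 ^- d * 1 < 2 ^- d * (2 * 2 ^+ d * (2 * alpha)) by rewrite (ltr_pM2l p0).
  have -> : 2 ^- d * (2 * 2 ^+ d * (2 * alpha)) = 2 ^- d * 2 ^+ d * (4 * alpha) by ring.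
  by rewrite pQ mul1r mulr1.
have m0 : (0 < m)%N.
  rewrite lt0n; apply/negP => /eqP m0; rewrite m0 in mgt; lra.
(* Both bounds come from [3 / 2 * delta <= m * alpha <= 2 * delta] and
   [2 * alpha <= 2 ^- d < 4 * alpha]. *)
have mp_hi : m%:R * 2 ^- d <= 8 * delta.
  by have := ler_wpM2l (ler0n R m) (ltW p_hi); lra.
have mp_lo : 3 * delta <= m%:R * 2 ^- d.
  by have := ler_wpM2l (ler0n R m) p_lo; lra.
exists (cylinder_union B); split.
- rewrite (card_cylinder_union R n m d B disjB cardB) natrX mulrC.
  rewrite ler_wpM2l ?exprn_ge0 //.
  have Hp : 1 + m%:R * 2 ^- d <= (1 + 2 ^- d) ^+ m :> R.
    by apply: bernoulli_inequality; lra.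
  (* (1 - p)^m <= 1 / (1 + p)^m <= 1 / (1 + m p) *)
  have Hm : (1 - 2 ^- d) ^+ m * (1 + 2 ^- d) ^+ m <= 1 :> R.
    have p21 : (2 ^- d) ^+ 2 <= 1 :> R by apply: exprn_ile1; lra.
    have p20 := sqr_ge0 (2 ^- d : R).
    by rewrite -exprMn -subr_sqr expr1n; apply: exprn_ile1; lra.
  have Hm0 : 0 <= (1 - 2 ^- d) ^+ m :> R by rewrite exprn_ge0 //; lra.
  have := le_trans (ler_wpM2l Hm0 Hp) Hm.
  move: (_ ^+ m) Hm0 (m%:R * _) mp_hi mp_lo => X X0 l l_hi l_lo XL.
  (* Then [X * (1 + 3 * delta) <= 1], while [(1 - delta) * (1 + 3 * delta) >= 1], so
     [X <= 1 - delta]. *)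
  have : X * (3 * delta) <= X * l by rewrite ler_wpM2l.
  nra.
- rewrite (card_cylinder_union R n m d B disjB cardB) natrX mulrC.
  rewrite ler_wpM2r ?exprn_ge0 //.
  have : 1 + m%:R * - 2 ^- d <= (1 - 2 ^- d) ^+ m :> R.
    by apply: bernoulli_inequality; lra.
  lra.
- apply: le_trans (card_spec_ge R n m d B alpha disjB cardB _); last first.
    have H : 1 + m.-1%:R * - 2 ^- d <= (1 - 2 ^- d) ^+ m.-1 :> R.
      by apply: bernoulli_inequality; lra.
    have m1 : m.-1%:R <= m%:R :> R by rewrite ler_nat leq_pred.
    (* Here [m * 2 ^- d <= 8 * delta <= 1 / 4]; then [3 / 4 * 2 ^- d >= 3 / 2 * alpha]. *)
    have H34 : 3 / 4 <= (1 - 2 ^- d) ^+ m.-1 :> R by nra.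
    nra.
  rewrite ler_pdivrMr ?mulr_gt0 ?exprn_gt0 //.
  have ma : 3 / 2 * delta <= m%:R * alpha by lra.
  (* Since [2 ^+ d * alpha > 1 / 4] and [alpha <= 1 / 64]. *)
  have Qa : 1 / 8 <= (2 ^+ d - 1) * alpha by lra.
  rewrite expr2; nra.
- move=> k k2 kle.
  have {}kle : (2 * k)%N%:R <= log2 (1 / (8 * delta)) by rewrite natrM mulrC -ler_pdivlMr.
  have k0 : (0 < k)%N by apply: leq_trans k2.
  have {}kle : 4 ^+ k * (8 * delta) <= 1.
    have z0 : 0 < 1 / (8 * delta) by rewrite divr_gt0 // mulr_gt0.
    move: kle; rewrite -exp2_le_log2 // ler_pdivlMr ?mulr_gt0 // exprM.
    by rewrite -natrX.
  (* The square is below [16 * alpha ^+ 2], and [alpha <= 1 / 64]. *)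
  have p2 : (2 ^- d) ^+ 2 < alpha by rewrite expr2; nra.
  rewrite ler_pdivlMr ?exprn_gt0 //.
  apply: le_trans (ler_wpM2r (exprn_ge0 _ (ltW alpha0))
    (Tk_dual_blocks R n m d k B _ disjB cardB k0
      (spec_sub_dual_blocks R n m d B alpha disjB cardB m0 p2))) _.
  have K1 : 1 <= 4 ^+ k :> R by rewrite exprn_ege1 // ler1n.
  (* The power is at most [expR 1], because [m * 2 ^- d * 4 ^+ k <= 8 * delta * 4 ^+ k <= 1] by the
     bound on [k]. *)
  have a4 : (1 + (4 ^+ k - 1) * 2 ^- d) ^+ m <= 4 :> R.
    apply: le_trans (expR1_le4 R).
    apply: (@le_trans _ _ (expR ((4 ^+ k - 1) * 2 ^- d) ^+ m)).
      rewrite lerXn2r ?nnegrE ?expR_ge0 ?expR_ge1Dx //.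
      by rewrite addr_ge0 // mulr_ge0 ?subr_ge0 // ltW.
    rewrite -expRM_natl ler_expR; nra.
  have a0 : 0 <= (1 + (4 ^+ k - 1) * 2 ^- d) ^+ m :> R.
    by rewrite exprn_ge0 // addr_ge0 // mulr_ge0 ?subr_ge0 // ltW.
  (* The base [2 ^+ d * alpha] is at most [1 / 2] and the exponent at least 2; this [1 / 4] absorbs
     the factor 4 of [a4]. *)
  have Qa : (2 ^+ d) ^+ (2 * k) * alpha ^+ (2 * k) <= 1 / 4.
    rewrite -exprMn; have Qa0 : 0 <= 2 ^+ d * alpha by rewrite mulr_ge0 ?ltW.
    apply: (@le_trans _ _ ((2 ^+ d * alpha) ^+ 2)).
      by rewrite ler_wiXn2l //; [lra | rewrite leq_pmulr].
    rewrite expr2; nra.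
  have Qa0 : 0 <= (2 ^+ d) ^+ (2 * k) * alpha ^+ (2 * k).
    by rewrite mulr_ge0 ?exprn_ge0 ?ltW.
  have mp0 : 0 <= m%:R * 2 ^- d :> R by rewrite mulr_ge0 // ltW.
  move: Qa Qa0 a4 a0 mp0 mp_hi.
  move: (_ ^+ (2 * k)) (_ ^+ (2 * k)) (_ ^+ m) (m%:R * _) => a' Q' X l.
  move=> Qa Qa0 X4 X0 l0 l8.
  have -> : Q' * l * X * a' = (Q' * a') * (l * X) by ring.
  have lX : l * X <= 32 * delta by nra.
  have lX0 : 0 <= l * X by rewrite mulr_ge0.
  nra.
Qed.
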